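(* Let $k\ge2$, let $\theta=1$, and let the replacement matrix $R$ be a star matrix with $0$ as a central vertex, i.e. $R$ is a $k\times k$ stochastic matrix with $R_{i,0}=1$ for all $i\neq 0$, such that $R\ne\begin{bmatrix}0&1\\1&0\end{bmatrix}$. Let $N_{n,j}$ be the number of times colour $j$ is selected in the first $n$ draws of the negative but linearly reinforced urn scheme with replacement matrix $R$, parameter $\theta=1$ and initial configuration $U_0$. Then $$\frac{N_{n,0}}{n}\longrightarrow 0\quad\text{a.s.}$$ and $$\frac{N_{n,j}}{n}\longrightarrow\frac{1}{k-1}\quad\text{a.s. for all } 1\le j\le k-1 .$$
   Context: Model (for parameter $\theta=1$). Let $k\ge 2$ be an integer, $S=\{0,1,\dots,k-1\}$ the set of colours, $R=((R_{i,j}))_{0\le i,j\le k-1}$ a stochastic matrix (nonnegative entries, all row sums equal to $1$), and $U_0=(U_{0,j})_{0\le j\le k-1}$ a (deterministic) probability vector on $S$. The negative but linearly reinforced urn scheme with initial configuration $U_0$, replacement matrix $R$ and $\theta=1$ is the process $(U_n)_{n\ge0}$ of random row vectors in $[0,\infty)^k$ defined recursively as follows. With $\mathcal F_n=\sigma(U_0,\dots,U_n)$, the random colour $Z_n\in S$ (the colour chosen at draw $n+1$) satisfies $$\mathbb P(Z_n=j\mid\mathcal F_n)=\frac{1}{k-1}\left(1-\frac{U_{n,j}}{n+1}\right),\quad 0\le j\le k-1,$$ and $U_{n+1}=U_n+\chi_{n+1}R$, where $\chi_{n+1}=(\mathbf 1(Z_n=j))_{0\le j\le k-1}$ is a row vector.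 (Then $\sum_j U_{n,j}=n+1$ for all $n$.) Colour counts: $N_{n,j}=\sum_{m=0}^{n-1}\mathbf 1(Z_m=j)$ for $0\le j\le k-1$.
   Formalization: The law of each draw is prescribed conditionally on U_0,...,U_n and all earlier draws Z_0,...,Z_{n-1}, not on U_0,...,U_n alone; with the latter the claim fails (k=3, all R_{i,0}=1, draws driven by one common uniform variable). *)

(* Defs.v *)
From mathcomp Require Import all_boot all_order all_algebra.
From mathcomp Require Import all_classical all_reals all_analysis.

Set Implicit Arguments.
Unset Strict Implicit.
Unset Printing Implicit Defensive.

Import Order.TTheory GRing.Theory Num.Theory.
Import numFieldNormedType.Exports.

Local Open Scope classical_set_scope.
Local Open Scope ring_scope.

Definition probability_vector (R : realType) (k : nat) (u : 'rV[R]_k) : Prop :=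
  (forall j, 0 <= u 0 j) /\ \sum_(j < k) u 0 j = 1.

Definition stochastic (R : realType) (k : nat) (M : 'M[R]_k) : Prop :=
  forall i, probability_vector (row i M).

(* The zeroth row of M is only constrained by stochasticity. *)
Definition star_matrix (R : realType) (k : nat) (M : 'M[R]_k) : Prop :=
  stochastic M /\
  forall i c : 'I_k, val i <> 0%N -> val c = 0%N -> M i c = 1.

(* f is a version of the conditional probability P(E | G), where G is a
   sub-sigma-algebra given by its collection of events. *)
Definition is_cond_prob (d : measure_display) (T : measurableType d)
    (R : realType) (P : probability T R) (G : set (set T)) (E : set T)
    (f : T -> R) : Prop :=
  [/\ forall B : set R, measurable B -> G (f @^-1` B),
      P.-integrable setT (EFin \o f)
    & forall A, G A -> P (E `&` A) = (\int[P]_(w in A) (f w)%:E)%E].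

(* sigma(U_0, ..., U_n, Z_0, ..., Z_(n-1)). The past draws are included because
   they cannot be recovered from the configurations when M has equal rows (as
   star matrices do for k >= 3): conditioning on sigma(U_0, ..., U_n) alone
   would not determine the joint law of the draws. *)
Definition urn_history (d : measure_display) (T : measurableType d)
    (R : realType) (k : nat) (U : nat -> T -> 'rV[R]_k) (Z : nat -> T -> 'I_k)
    (n : nat) : set (set T) :=
  <<s [set A | (exists m j (B : set R),
                  [/\ (m <= n)%N, measurable B & A = [set w | B (U m w 0 j)]])
            \/ (exists m j, (m < n)%N /\ A = [set w | Z m w = j])] >>.

(* Z n is the colour chosen at draw n + 1, U n the configuration before it. *)
Record neg_linear_urn (d : measure_display) (T : measurableType d)
    (R : realType) (P : probability T R) (k : nat) (M : 'M[R]_k)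
    (U0 : 'rV[R]_k) (U : nat -> T -> 'rV[R]_k) (Z : nat -> T -> 'I_k) : Prop :=
  NegLinearUrn {
    urn_measurable_draw : forall n j, measurable [set w | Z n w = j];
    urn_init : forall w, U 0%N w = U0;
    urn_step : forall n w,
      U n.+1 w = U n w + (\row_j (Z n w == j)%:R) *m M;
    urn_draw : forall n j,
      is_cond_prob P (urn_history U Z n) [set w | Z n w = j]
        (fun w => (k%:R - 1)^-1 * (1 - U n w 0 j / n.+1%:R)) }.

Definition colour_count (T : Type) (k : nat) (Z : nat -> T -> 'I_k)
    (n : nat) (j : 'I_k) (w : T) : nat :=
  (\sum_(m < n) (Z m w == j))%N.

(* Main.v *)
Require Import Defs.
From mathcomp Require Import all_boot all_order all_algebra.
From mathcomp Require Import all_classical all_reals all_analysis.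
From mathcomp Require Import measurable_realfun.
From mathcomp Require Import ring lra zify.

Set Implicit Arguments.
Unset Strict Implicit.
Unset Printing Implicit Defensive.

Import Order.TTheory GRing.Theory Num.Theory.
Import numFieldNormedType.Exports.

Local Open Scope classical_set_scope.
Local Open Scope ring_scope.

(** Write N_n(j) for the number of draws of colour j among the first n draws
    and p_n(j) for the conditional probability of drawing j at draw n + 1.

    A strong law for the draws (urn_slln) says that, almost surely, N_n(j)/n
    and the average of p_0(j), ..., p_(n-1)(j) have the same asymptotic
    behaviour.  The increments X_n = 1(Z_n = j) - p_n(j) are bounded by 1 and
    their partial sums S_n satisfy E[S_n X_n] = 0, so E[S_n^2] <= n.  Hence
    S_n/n tends to 0 along the squares, because the second moments of these
    ratios are summable, and S_n moves by at most 1 at each step, which fills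
    the gaps between consecutive squares (orthogonal_slln).  The relation
    E[S_n X_n] = 0 is elementary: S_n is an affine combination of
    indicators of past draws, and E[1_A X_n] = 0 for every event A of the past.

    The rest is deterministic, on one trajectory.  A draw of the centre c adds
    M c c to its own content and every other draw adds 1, so p_n(c) is
    r N_n(c)/n up to a term of order 1/n, where r = (1 - M c c)/(k - 1).
    The excluded matrix is the only star matrix with r = 1; otherwise r < 1
    and N_n(c)/n, which is asymptotically at most r times its own running
    average, must tend to 0 (averaged_contraction).
    A leaf j receives mass only from draws of the centre, so its content is
    o(n), p_n(j) tends to 1/(k - 1), and so does N_n(j)/n by the strong law. *)

(** * Averages of real sequences *)

Definition average (R : realType) (u : nat -> R) (n : nat) : R :=
  (\sum_(m < n) u m) / n%:R.

Lemma average_cvg (R : realType) (u : nat -> R) (l : R) :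
  u n @[n --> \oo] --> l -> average u n @[n --> \oo] --> l.
Proof.
move=> ul; rewrite -cvg_shiftS.
suff -> : (fun n => average u n.+1) = arithmetic_mean u by exact: cesaro.
by apply/funext => n; rewrite /average /arithmetic_mean seriesEord /= mulrC.
Qed.

Lemma averageB (R : realType) (u v : nat -> R) (n : nat) :
  average (fun m => u m - v m) n = average u n - average v n.
Proof. by rewrite /average sumrB mulrBl. Qed.

Lemma square_bracket (n : nat) : (0 < n)%N ->
  exists m, (m.+1 ^ 2 <= n < m.+2 ^ 2)%N.
Proof.
elim: n => // -[_ _|n IH _]; first by exists 0%N.
have [m /andP[lo hi]] := IH isT.
have [hi'|hi'] := ltnP n.+2 (m.+2 ^ 2); first by exists m; lia.
by exists m.+1; rewrite hi' /=; nia.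
Qed.

(** For m^2 <= n < (m+1)^2 the distance from n to m^2 is at most 2m, which is
    negligible compared with n, so the ratio at n differs from the one at m^2
    by O(1/m). *)
Lemma lipschitz_squares (R : realType) (s : nat -> R) :
  (forall n, `|s n.+1 - s n| <= 1) ->
  s (n.+1 ^ 2)%N / (n.+1 ^ 2)%:R @[n --> \oo] --> (0 : R) ->
  s n / n%:R @[n --> \oo] --> (0 : R).
Proof.
move=> lip sq0.
have lipD p q : `|s (p + q)%N - s p| <= q%:R.
  elim: q => [|q IH]; first by rewrite addn0 subrr normr0.
  rewrite addnS -(subrK (s (p + q)%N) (s _.+1)) -addrA -natr1 addrC.
  by rewrite (le_trans (ler_normD _ _)) // lerD.
(* The increment over n - (m+1)^2 <= 2m + 2 steps is at most 3 (m+1), and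
   dividing by (m+1)^2 gives the harmonic term. *)
pose b m := `|s (m.+1 ^ 2)%N / (m.+1 ^ 2)%:R| + 3 * harmonic m : R.
have b0 : b m @[m --> \oo] --> (0 : R).
  rewrite -(addr0 0); apply: cvgD.
    by rewrite -[X in _ --> X](@normr0 _ R); apply: cvg_norm.
  rewrite -(mulr0 3); apply: cvgMr; exact: cvg_harmonic.
apply/cvgrPdist_le => e e0.
move/cvgrPdist_le : b0 => /(_ _ e0)[N _ HN].
exists (N.+1 ^ 2)%N => // n /= Nn.
have n0 : (0 < n)%N by apply: leq_trans Nn; rewrite expn_gt0.
have [m /andP[lo hi]] := square_bracket n0.
have Nm : (N <= m)%N.
  rewrite -ltnS -ltnS ltnNge; apply/negP => h.
  suff : (m.+2 ^ 2 <= N.+1 ^ 2)%N by lia.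
  by rewrite leq_sqr.
have := HN m Nm; rewrite !sub0r !normrN; apply: le_trans.
rewrite [leRHS]ger0_norm; last first.
  by rewrite /b addr_ge0 // mulr_ge0 // harmonic_ge0.
have n0' : (0 : R) < n%:R by rewrite ltr0n.
have q0 : (0 : R) < (m.+1 ^ 2)%:R by rewrite ltr0n expn_gt0.
rewrite normrM normfV (gtr0_norm n0') ler_pdivrMr //.
apply: (@le_trans _ _ (b m * (m.+1 ^ 2)%:R)); last first.
  rewrite ler_wpM2l ?ler_nat //.
  by rewrite /b addr_ge0 // mulr_ge0 // harmonic_ge0.
rewrite /b mulrDl normrM normfV (gtr0_norm q0) mulfVK ?gt_eqF //.
rewrite /= -mulrA natrX expr2 mulKf ?pnatr_eq0 //.
rewrite -(subrKC (s (m.+1 ^ 2)%N) (s n)) (le_trans (ler_normD _ _)) // lerD //.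
rewrite -{1}(subnKC lo) (le_trans (lipD _ _)) //.
by rewrite -natrM ler_nat; nia.
Qed.

(** If L is the upper limit of x, averaging the bound x <= sups x gives
    L <= c L in the limit, which forces L = 0 when c < 1. *)
Lemma averaged_contraction (R : realType) (x b e : nat -> R) (c K : R) :
  c < 1 -> 0 <= c ->
  (forall n, 0 <= x n <= K) ->
  b n @[n --> \oo] --> (0 : R) -> e n @[n --> \oo] --> (0 : R) ->
  (forall n, x n <= average (fun m => c * x m + b m) n + e n) ->
  x n @[n --> \oo] --> (0 : R).
Proof.
move=> c1 c0 xK b0 e0 hx.
have ub : has_ubound (range x).
  by exists K => _ [n _ <-]; case/andP: (xK n).
have lb : has_lbound (range x).
  by exists 0 => _ [n _ <-]; case/andP: (xK n).
have := cvg_sups_inf ub lb; set L := inf _ => supL.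
have xsup n : x n <= sups x n.
  by apply: ub_le_sup; [exact: has_ubound_sdrop | exists n => /=].
pose g n := average (fun m => c * sups x m + b m) n + e n.
have gL : g n @[n --> \oo] --> c * L.
  rewrite -[X in _ --> X]addr0 -[X in _ --> X + _]addr0.
  apply: cvgD => //; apply: average_cvg; apply: cvgD => //.
  exact: cvgMr.
have xg n : x n <= g n.
  apply: (le_trans (hx n)); rewrite lerD2r ler_wpM2r // ler_sum // => m _.
  by rewrite lerD2r ler_wpM2l.
have supg n : sups x n <= sups g n.
  apply: ge_sup; first by exists (x n), n => /=.
  move=> _ [m /= nm <-]; apply: (le_trans (xg m)).
  apply: ub_le_sup; last by exists m.
  apply: has_ubound_sdrop; apply: bounded_fun_has_ubound.
  by apply: cvg_seq_bounded; apply/cvg_ex; exists (c * L).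
have LcL : L <= c * L by apply: (ler_cvg_to supL (cvg_sups gL)); apply: nearW.
have L0 : 0 <= L.
  apply: (cvgr_to_ge supL); apply: nearW => n.
  by apply: le_trans (xsup n); case/andP: (xK n).
have {}L0 : L = 0 by nra.
rewrite L0 in supL.
apply: (@squeeze_cvgr _ _ _ _ (cst 0) (sups x)) => //; last exact: cvg_cst.
by apply: nearW => n; rewrite xsup andbT; case/andP: (xK n).
Qed.

(** * A strong law for orthogonal bounded increments *)

Definition bounded_measurable (d : measure_display) (T : measurableType d)
    (R : realType) (g : T -> R) : Prop :=
  measurable_fun setT g /\ exists K, forall w, `|g w| <= K.

Lemma bounded_measurable_cst (d : measure_display) (T : measurableType d)
    (R : realType) (r : R) : bounded_measurable (fun _ : T => r).
Proof. by split; [exact: measurable_cst | exists `|r|]. Qed.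

Lemma bounded_measurableD (d : measure_display) (T : measurableType d)
    (R : realType) (f g : T -> R) : bounded_measurable f ->
  bounded_measurable g -> bounded_measurable (fun w => f w + g w).
Proof.
move=> [mf [K fK]] [mg [L gL]]; split; first exact: measurable_funD.
by exists (K + L) => w; rewrite (le_trans (ler_normD _ _)) // lerD.
Qed.

Lemma bounded_measurableM (d : measure_display) (T : measurableType d)
    (R : realType) (f g : T -> R) : bounded_measurable f ->
  bounded_measurable g -> bounded_measurable (fun w => f w * g w).
Proof.
move=> [mf [K fK]] [mg [L gL]]; split; first exact: measurable_funM.
by exists (K * L) => w; rewrite normrM ler_pM.
Qed.

Lemma bounded_measurable_sum (d : measure_display) (T : measurableType d)
    (R : realType) (f : nat -> T -> R) (n : nat) :
  (forall m, bounded_measurable (f m)) ->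
  bounded_measurable (fun w => \sum_(m < n) f m w).
Proof.
move=> bf; elim: n => [|n IH].
  under [X in bounded_measurable X]eq_fun do rewrite big_ord0.
  exact: bounded_measurable_cst.
under [X in bounded_measurable X]eq_fun do rewrite big_ord_recr.
exact: bounded_measurableD.
Qed.

Lemma bounded_measurable_integrable (d : measure_display)
    (T : measurableType d) (R : realType) (P : probability T R) (g : T -> R) :
  bounded_measurable g -> P.-integrable setT (EFin \o g).
Proof.
move=> [mg [K gK]]; apply: measurable_bounded_integrable => //.
  by rewrite (le_lt_trans (probability_le1 P _)) ?ltry.
exists K; split; first exact: num_real.
by move=> M KM w _; apply: le_trans (gK w) (ltW KM).
Qed.

(** The bound telescopes: 1/(n+1)^2 <= 1/n - 1/(n+1).  At n = 0 it reads
    0 <= 2, since the inverse of 0 is 0. *)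
Lemma sum_inv_squares (R : realType) (n : nat) :
  \sum_(m < n) (m.+1 ^ 2)%:R^-1 <= 2 - n%:R^-1 :> R.
Proof.
elim: n => [|n IH]; first by rewrite big_ord0 invr0; lra.
rewrite big_ord_recr /=; case: n IH => [_|n IH].
  by rewrite big_ord0 exp1n invr1; lra.
apply: le_trans (lerD IH (lexx _)) _.
have x0 : (0 : R) < n.+1%:R by rewrite ltr0n.
rewrite natrX -[n.+2%:R]natr1; move: n.+1%:R x0 => {IH}x x0.
rewrite -subr_ge0 (_ : _ - _ = x^-1 * (x + 1) ^- 2).
  by rewrite mulr_ge0 // invr_ge0 ?exprn_ge0 //; lra.
by field; lra.
Qed.

(** Expanding the square of the next partial sum, the cross term vanishes by
    orthogonality and the new square contributes at most 1. *)
Lemma second_moment_sum (d : measure_display) (T : measurableType d)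
    (R : realType) (P : probability T R) (D : nat -> T -> R) :
  (forall n, measurable_fun setT (D n)) ->
  (forall n w, `|D n w| <= 1) ->
  (forall n, \int[P]_w ((\sum_(m < n) D m w) * D n w) = 0) ->
  forall n, \int[P]_w ((\sum_(m < n) D m w) ^+ 2) <= n%:R.
Proof.
move=> mD D1 orth.
have bD n : bounded_measurable (D n) by split => //; exists 1.
have bS n : bounded_measurable (fun w => \sum_(m < n) D m w).
  exact: bounded_measurable_sum.
have int f : bounded_measurable f -> P.-integrable setT (EFin \o f).
  exact: bounded_measurable_integrable.
elim=> [|n IH].
  under eq_Rintegral do rewrite big_ord0 expr0n.
  by rewrite Rintegral_cst // mul0r.
have eqS w : (\sum_(m < n.+1) D m w) ^+ 2 = (\sum_(m < n) D m w) ^+ 2 +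
    2 * ((\sum_(m < n) D m w) * D n w) + D n w ^+ 2.
  by rewrite big_ord_recr /=; ring.
under eq_Rintegral do rewrite eqS.
have b1 := bounded_measurableM (bS n) (bS n).
have b2 := bounded_measurableM (bS n) (bD n).
have b3 := bounded_measurableM (bD n) (bD n).
have b4 := bounded_measurableM (bounded_measurable_cst T (2 : R)) b2.
rewrite RintegralD //; last 2 first.
- exact/int/bounded_measurableD.
- exact/int.
rewrite RintegralD //; last 2 first.
- exact/int.
- exact/int.
rewrite RintegralZl //; last exact/int.
rewrite orth mulr0 addr0 -natr1 lerD //.
have -> : 1 = \int[P]_(w in setT) (1 : R).
  by rewrite Rintegral_cst //= mul1r probability_setT.
apply: le_Rintegral => //; [exact/int|exact/int/bounded_measurable_cst|].
move=> w _; rewrite -real_normK ?num_real // expr2.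
by rewrite -[leRHS]mulr1 ler_pM.
Qed.

(** The squared averages along the squares have expectations at most
    1/(m+1)^2, so their sum is integrable, hence almost surely finite, and its
    terms tend to 0; lipschitz_squares covers the remaining indices. *)
Lemma orthogonal_slln (d : measure_display) (T : measurableType d)
    (R : realType) (P : probability T R) (D : nat -> T -> R) :
  (forall n, measurable_fun setT (D n)) ->
  (forall n w, `|D n w| <= 1) ->
  (forall n, \int[P]_w ((\sum_(m < n) D m w) * D n w) = 0) ->
  {ae P, forall w, average (D^~ w) n @[n --> \oo] --> (0 : R)}.
Proof.
move=> mD D1 orth.
pose S n w := \sum_(m < n) D m w.
have bS n : bounded_measurable (S n).
  by apply: bounded_measurable_sum => m; split => //; exists 1.
have S2 n : \int[P]_w (S n w ^+ 2) <= n%:R by exact: second_moment_sum.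
pose q m w := (S (m.+1 ^ 2)%N w / (m.+1 ^ 2)%:R) ^+ 2.
have qE m : q m = fun w => (m.+1 ^ 2)%:R ^- 2 * S (m.+1 ^ 2)%N w ^+ 2.
  by apply/funext => w; rewrite /q expr_div_n mulrC.
have q0 m w : 0 <= q m w by rewrite sqr_ge0.
have bS2 n : bounded_measurable (fun w => S n w ^+ 2).
  exact: bounded_measurableM.
have bq m : bounded_measurable (q m).
  rewrite qE; apply: bounded_measurableM => //.
  exact: bounded_measurable_cst.
have Eq m : (\int[P]_w (q m w)%:E <= ((m.+1 ^ 2)%:R^-1)%:E)%E.
  have /bounded_measurable_integrable iq := bq m.
  rewrite -[leLHS]fineK; last exact: integrable_fin_num (iq P).
  rewrite lee_fin -/(Rintegral P setT (q m)) qE RintegralZl //; last first.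
    exact: bounded_measurable_integrable.
  rewrite ler_pdivrMl; last by rewrite exprn_gt0 // ltr0n expn_gt0.
  by rewrite (le_trans (S2 _)) // expr2 mulfK // pnatr_eq0.
have mq m : measurable_fun setT (fun w => (q m w)%:E).
  by apply/measurable_EFinP; case: (bq m).
have mQ : measurable_fun setT (fun w => (\sum_(m <oo) (q m w)%:E)%E).
  by apply: ge0_emeasurable_sum => // m w _ _; rewrite lee_fin.
have iQ : P.-integrable setT (fun w => (\sum_(m <oo) (q m w)%:E)%E).
  apply/integrableP; split => //.
  under eq_integral.
    move=> w _; rewrite gee0_abs; last first.
      by apply: nneseries_ge0 => m _ _; rewrite lee_fin.
    over.
  rewrite integral_nneseries //; last by move=> m w _; rewrite lee_fin.
  apply: (@le_lt_trans _ _ 2%:E); last exact: ltry.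
  apply: lime_le.
    apply: is_cvg_nneseries => m _ _.
    by apply: integral_ge0 => w _; rewrite lee_fin.
  apply: nearW => n.
  apply: (@le_trans _ _ (\sum_(0 <= m < n) ((m.+1 ^ 2)%:R^-1 : R)%:E)%E).
    exact: lee_sum.
  rewrite sumEFin lee_fin big_mkord (le_trans (sum_inv_squares R n)) //.
  by rewrite lerBlDr lerDl invr_ge0.
apply: filterS (integrable_ae measurableT iQ) => w /(_ I) finQ.
rewrite /average; apply: (@lipschitz_squares _ (fun n => S n w)) => [n|].
  by rewrite /S big_ord_recr /= [_ + D n w]addrC addrK.
have cvq : q m w @[m --> \oo] --> (0 : R).
  apply: cvg_series_cvg_0; apply: nnseries_is_cvg => //.
  by rewrite ltey_eq finQ.
apply/cvgrPdist_le => e e0.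
move/cvgrPdist_le : cvq => /(_ _ (exprn_gt0 2 e0)).
apply: filterS => m; rewrite !sub0r !normrN ger0_norm //.
rewrite /q; set a := _ / _; rewrite -(real_normK (num_real a)).
by rewrite ler_pXn2r // nnegrE ltW.
Qed.

(** * Functions of the past are orthogonal to the draw innovations *)

(** The test functions against which X has zero integral form a vector space.
    This is what lets orthogonality pass from events of the past to the affine
    functions of past draws that occur in the urn. *)
Definition orthogonal_to (d : measure_display) (T : measurableType d)
    (R : realType) (P : probability T R) (X f : T -> R) : Prop :=
  bounded_measurable f /\ \int[P]_w (f w * X w) = 0.

Lemma orthogonal_toD (d : measure_display) (T : measurableType d)
    (R : realType) (P : probability T R) (X f g : T -> R) :
  bounded_measurable X -> orthogonal_to P X f -> orthogonal_to P X g ->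
  orthogonal_to P X (fun w => f w + g w).
Proof.
move=> bX [bf f0] [bg g0]; split; first exact: bounded_measurableD.
under eq_Rintegral do rewrite mulrDl.
by rewrite RintegralD ?f0 ?g0 ?addr0 //;
  exact/bounded_measurable_integrable/bounded_measurableM.
Qed.

Lemma orthogonal_toZ (d : measure_display) (T : measurableType d)
    (R : realType) (P : probability T R) (X f : T -> R) (r : R) :
  bounded_measurable X -> orthogonal_to P X f ->
  orthogonal_to P X (fun w => r * f w).
Proof.
move=> bX [bf f0]; split.
  exact/bounded_measurableM/bf/bounded_measurable_cst.
under eq_Rintegral do rewrite -mulrA.
rewrite RintegralZl ?f0 ?mulr0 //.
exact/bounded_measurable_integrable/bounded_measurableM.
Qed.

Lemma orthogonal_to_sum (d : measure_display) (T : measurableType d)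
    (R : realType) (P : probability T R) (X : T -> R) (I : finType)
    (f : I -> T -> R) :
  bounded_measurable X -> (forall i, orthogonal_to P X (f i)) ->
  orthogonal_to P X (fun w => \sum_i f i w).
Proof.
move=> bX orthf.
rewrite (_ : (fun w => _) = \sum_i f i); last first.
  by apply/funext => w; rewrite fct_sumE.
elim/big_ind : _ => [|g h ug uh|i _]; last exact: orthf.
  split; first exact: bounded_measurable_cst.
  by under eq_Rintegral do rewrite mul0r; rewrite Rintegral_cst // mul0r.
exact: orthogonal_toD.
Qed.

Lemma cond_prob_orthogonal (d : measure_display) (T : measurableType d)
    (R : realType) (P : probability T R) (G : set (set T)) (E A : set T)
    (f : T -> R) :
  measurable E -> measurable A -> G A -> is_cond_prob P G E f ->
  bounded_measurable f ->
  orthogonal_to P (fun w => \1_E w - f w) (\1_A : T -> R).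
Proof.
move=> mE mA GA [_ intf PE] bf; split.
  split; first exact: measurable_indic.
  by exists 1 => w; rewrite indicE; case: (_ \in _); rewrite ?normr1 ?normr0.
(* The two integrals of the difference below are the two sides of the
   defining identity of conditional probability on A. *)
have splitA w : \1_A w * (\1_E w - f w) = \1_(E `&` A) w - (f \_ A) w.
  rewrite mulrBr setIC indicI; congr (_ - _).
  by rewrite patchE indicE; case: (_ \in _); rewrite ?mul1r ?mul0r.
under eq_Rintegral do rewrite splitA.
have mEA : measurable (E `&` A) by exact: measurableI.
rewrite RintegralB //; last 2 first.
- exact: integrable_indic.
- rewrite -restrict_EFin; apply/(integrable_mkcond _ mA).
  by apply: (integrableS measurableT _ _ intf).
rewrite -Rintegral_mkcond /Rintegral integral_indic // setIT /= PE //.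
by rewrite subrr.
Qed.

(** * Star matrices *)

Lemma natr_le_subr1 (R : realType) (m k : nat) :
  (m < k)%N -> m%:R <= k%:R - 1 :> R.
Proof. by move=> mk; rewrite lerBrDr natr1 ler_nat. Qed.

Lemma probability_vector_itv (R : realType) (k : nat) (u : 'rV[R]_k)
    (j : 'I_k) :
  probability_vector u -> 0 <= u 0 j <= 1.
Proof.
move=> [u0 u1]; rewrite u0 -u1 (bigD1 j) //= lerDl.
by apply: sumr_ge0 => i _.
Qed.

Lemma stochastic_itv (R : realType) (k : nat) (M : 'M[R]_k) (i j : 'I_k) :
  stochastic M -> 0 <= M i j <= 1.
Proof. by move=> sM; have := probability_vector_itv j (sM i); rewrite mxE. Qed.

(** The entry 1 in the centre column already exhausts the row sum. *)
Lemma star_matrix_off_centre (R : realType) (k : nat) (M : 'M[R]_k)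
    (c i j : 'I_k) :
  star_matrix M -> val c = 0%N -> i != c -> j != c -> M i j = 0.
Proof.
move=> [sM star] c0 ic jc; have [M0 M1] := sM i.
have ic0 : val i <> 0%N.
  by move=> i0; case/eqP: ic; apply: val_inj; rewrite i0 c0.
move: M1; rewrite (bigD1 c) //= mxE (star i c) // (bigD1 j) //= mxE.
have := M0 j; rewrite mxE => Mij0.
have : 0 <= \sum_(l < k | (l != c) && (l != j)) row i M 0 l.
  by apply: sumr_ge0 => l _.
by move: (\sum_(l < k | _) _) => s; lra.
Qed.

(** For k >= 3 the factor (k - 1)^-1 is at most 1/2.  For k = 2 the product is
    1 - M c c, which equals 1 only if M c c = 0; both rows of M are then
    determined and M is the swap. *)
Lemma star_matrix_contraction (R : realType) (k : nat) (M : 'M[R]_k)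
    (c : 'I_k) :
  (2 <= k)%N -> star_matrix M -> val c = 0%N ->
  ~ (k = 2%N /\ M = \matrix_(i, j) (i != j)%:R) ->
  (k%:R - 1)^-1 * (1 - M c c) < 1.
Proof.
move=> k2 hM c0 nswap.
have /andP[Mcc0 Mcc1] := stochastic_itv c c hM.1.
have k1 : (1 : R) <= k%:R - 1 by exact: (natr_le_subr1 R k2).
rewrite ltr_pdivrMl ?mulr1; last by lra.
have [k3|k_le2] := ltnP 2 k.
  suff : (2 : R) <= k%:R - 1 by lra.
  exact: natr_le_subr1.
(* As k - 1 >= 1, the bound can only fail for M c c = 0. *)
suff Mcc : M c c != 0.
  by have := lt_def 0 (M c c); rewrite Mcc Mcc0 /=; lra.
apply/eqP => Mcc; apply: nswap.
have kE : k = 2%N by lia.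
split=> //; apply/matrixP => i j; rewrite mxE.
have neq0 (l : 'I_k) : l != c -> val l <> 0%N.
  by move=> lc l0; case/eqP: lc; apply: val_inj; rewrite l0 c0.
have [->|ic] := eqVneq i c; have [->|jc] := eqVneq j c.
- by rewrite Mcc.
- have [_] := hM.1 c; rewrite (bigD1 c) //= mxE Mcc add0r (bigD1 j) //= mxE.
  rewrite big1 ?addr0 => [->|l /andP[lc lj]] //.
  have := neq0 _ lc; have := neq0 _ jc; have : val l <> val j.
    by move=> /val_inj lj'; rewrite lj' eqxx in lj.
  by have := ltn_ord l; have := ltn_ord j; move=> /=; lia.
- by rewrite (hM.2 i c) // ?ic //; exact: neq0.
- rewrite (star_matrix_off_centre hM c0) //.
  suff -> : i = j by rewrite eqxx.
  have := neq0 _ ic; have := neq0 _ jc; have := ltn_ord i; have := ltn_ord j.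
  by move=> /= ? ? ? ?; apply: val_inj => /=; lia.
Qed.

(** * The strong law for the draws *)

Lemma urn_content_step (d : measure_display) (T : measurableType d)
    (R : realType) (P : probability T R) (k : nat) (M : 'M[R]_k)
    (U0 : 'rV[R]_k) (U : nat -> T -> 'rV[R]_k) (Z : nat -> T -> 'I_k) :
  neg_linear_urn P M U0 U Z ->
  forall n w j, U n.+1 w 0 j = U n w 0 j + M (Z n w) j.
Proof.
move=> urn n w j; rewrite (urn_step urn) mxE; congr (_ + _).
rewrite mxE (bigD1 (Z n w)) //= mxE eqxx mul1r big1 ?addr0 // => i iZ.
by rewrite mxE eq_sym (negbTE iZ) mul0r.
Qed.

Definition draw_probability (T : Type) (R : realType) (k : nat)
    (U : nat -> T -> 'rV[R]_k) (n : nat) (j : 'I_k) (w : T) : R :=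
  (k%:R - 1)^-1 * (1 - U n w 0 j / n.+1%:R).

(** Each draw adds an entry of M, hence at most 1, to a given content; the
    content before draw n + 1 therefore lies in [0, n + 1]. *)
Lemma draw_probability_itv (d : measure_display) (T : measurableType d)
    (R : realType) (P : probability T R) (k : nat) (M : 'M[R]_k)
    (U0 : 'rV[R]_k) (U : nat -> T -> 'rV[R]_k) (Z : nat -> T -> 'I_k) :
  (2 <= k)%N -> stochastic M -> probability_vector U0 ->
  neg_linear_urn P M U0 U Z ->
  forall n j w, 0 <= draw_probability U n j w <= 1.
Proof.
move=> k2 sM pU0 urn n j w.
have /andP[U_ge0 U_le] : 0 <= U n w 0 j <= n.+1%:R.
  elim: n => [|n IH]; first by rewrite (urn_init urn) probability_vector_itv.
  rewrite (urn_content_step urn) -natr1.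
  by have := stochastic_itv (Z n w) j sM; lra.
have k1 : (1 : R) <= k%:R - 1 by exact: (natr_le_subr1 R k2).
have n0 : (0 : R) < n.+1%:R by rewrite ltr0n.
have q_le1 : U n w 0 j / n.+1%:R <= 1 by rewrite ler_pdivrMr // mul1r.
have q_ge0 : 0 <= U n w 0 j / n.+1%:R by rewrite divr_ge0 // ltW.
rewrite /draw_probability; apply/andP; split.
  apply: mulr_ge0; first by rewrite invr_ge0 (le_trans ler01).
  by rewrite subr_ge0.
rewrite ler_pdivrMl ?mulr1 ?(lt_le_trans ltr01) //.
by apply: le_trans k1; rewrite lerBlDr lerDl.
Qed.

(** The reduction to orthogonal_slln: configurations, and with them the draw
    probabilities, are affine in the indicators of past draws because U 0 is
    deterministic. *)
Lemma urn_slln (d : measure_display) (T : measurableType d)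
    (R : realType) (P : probability T R) (k : nat) (M : 'M[R]_k)
    (U0 : 'rV[R]_k) (U : nat -> T -> 'rV[R]_k) (Z : nat -> T -> 'I_k) :
  (2 <= k)%N -> stochastic M -> probability_vector U0 ->
  neg_linear_urn P M U0 U Z ->
  forall j, {ae P, forall w,
    average (fun n => (Z n w == j)%:R - draw_probability U n j w) n
      @[n --> \oo] --> (0 : R)}.
Proof.
move=> k2 sM pU0 urn j.
pose X n w : R := (Z n w == j)%:R - draw_probability U n j w.
have pitv := draw_probability_itv k2 sM pU0 urn.
have indE n i : (fun w => (Z n w == i)%:R) = \1_[set w | Z n w = i] :> (T -> R).
  apply/funext => w; rewrite indicE; congr (_%:R); congr nat_of_bool.
  by apply/eqP/idP; rewrite inE.
have mZ n i := urn_measurable_draw urn n i.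
have bp n i : bounded_measurable (draw_probability U n i).
  split; last by exists 1 => w; have := pitv n i w; rewrite ler_norml; lra.
  by apply/measurable_EFinP; have [_ /measurable_int] := urn_draw urn n i.
have bX n : bounded_measurable (X n).
  rewrite /X; apply: bounded_measurableD.
    rewrite indE; split; first exact: measurable_indic.
    by exists 1 => w; rewrite indicE; case: (_ \in _); rewrite ?normr1 ?normr0.
  under [X in bounded_measurable X]eq_fun do rewrite -mulN1r.
  exact/bounded_measurableM/bp/bounded_measurable_cst.
have X1 n w : `|X n w| <= 1.
  by have := pitv n j w; rewrite /X ler_norml; case: (_ == _) => /=; lra.
have orthA n A : measurable A -> urn_history U Z n A ->
    orthogonal_to P (X n) (\1_A).
  move=> mA hA; have /(_ (bp n j)) :=
    cond_prob_orthogonal (mZ n j) mA hA (urn_draw urn n j).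
  by rewrite -indE.
have orth1 n : orthogonal_to P (X n) (fun=> 1).
  have := orthA n setT measurableT; rewrite indicT; apply.
  rewrite -[X in urn_history _ _ _ X]setC0.
  by apply: sigma_algebraC; apply: sigma_algebra0.
have orthc n r : orthogonal_to P (X n) (fun=> r).
  have := orthogonal_toZ r (bX n) (orth1 n).
  by under [Y in orthogonal_to _ _ Y]eq_fun do rewrite mulr1.
have orthZ n m i : (m < n)%N -> orthogonal_to P (X n) (fun w => (Z m w == i)%:R).
  move=> mn; rewrite indE; apply: orthA => //.
  by apply: sub_sigma_algebra; right; exists m, i.
(* Induction on m <= n: only draws made before draw m + 1 enter U m. *)
have orthU n m i : (m <= n)%N -> orthogonal_to P (X n) (fun w => U m w 0 i).
  elim: m => [_|m IH mn].
    by under [Y in orthogonal_to _ _ Y]eq_fun do rewrite (urn_init urn).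
  rewrite (_ : (fun w => _) = fun w =>
      U m w 0 i + \sum_l M l i * (Z m w == l)%:R); last first.
    apply/funext => w; rewrite (urn_content_step urn) (bigD1 (Z m w)) //=.
    rewrite eqxx mulr1 big1 ?addr0 // => l lZ.
    by rewrite eq_sym (negbTE lZ) mulr0.
  apply: orthogonal_toD => //; first exact/IH/ltnW.
  by apply: orthogonal_to_sum => // l; apply: orthogonal_toZ => //; exact: orthZ.
apply: (@orthogonal_slln _ _ _ _ X) => //; first by move=> n; case: (bX n).
move=> n; suff [] : orthogonal_to P (X n) (fun w => \sum_(m < n) X m w) by [].
apply: orthogonal_to_sum => // m; rewrite [X m]/X.
rewrite [Y in orthogonal_to _ _ Y](_ : _ = fun w => (Z m w == j)%:R +
    (- (k%:R - 1)^-1 + ((k%:R - 1)^-1 / m.+1%:R) * U m w 0 j)); last first.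
  apply/funext => w; rewrite /draw_probability.
  by move: (k%:R - 1)^-1 m.+1%:R^-1 => a b; ring.
apply: orthogonal_toD => //; first exact: orthZ.
apply: orthogonal_toD => //.
by apply: orthogonal_toZ => //; apply: orthU; exact: ltnW.
Qed.

(** * Colour frequencies along one trajectory *)

Lemma colour_countS (T : Type) (k : nat) (Z : nat -> T -> 'I_k) (n : nat)
    (j : 'I_k) (w : T) :
  colour_count Z n.+1 j w = (colour_count Z n j w + (Z n w == j))%N.
Proof. by rewrite /colour_count big_ord_recr. Qed.

Lemma colour_frequency (T : Type) (R : realType) (k : nat)
    (Z : nat -> T -> 'I_k) (n : nat) (j : 'I_k) (w : T) :
  (colour_count Z n j w)%:R / n%:R = average (fun m => (Z m w == j)%:R) n :> R.
Proof. by rewrite /average /colour_count natr_sum. Qed.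

Lemma colour_frequency_itv (T : Type) (R : realType) (k : nat)
    (Z : nat -> T -> 'I_k) (n : nat) (j : 'I_k) (w : T) :
  0 <= ((colour_count Z n j w)%:R / n%:R : R) <= 1.
Proof.
rewrite divr_ge0 //=; case: n => [|n]; first by rewrite invr0 mulr0.
rewrite ler_pdivrMr ?ltr0n // mul1r ler_nat.
elim: n.+1 => [|m IH]; first by rewrite /colour_count big_ord0.
by rewrite colour_countS; case: (_ == _) => /=; lia.
Qed.

(** The content of the centre misses the total mass n + 1 by an amount that
    grows by 1 - M c c exactly when the centre is drawn.  Its draw probability
    is thus at most a factor below 1 times its frequency, plus O(1/n), and the
    strong law turns this into the hypothesis of averaged_contraction. *)
Lemma centre_frequency_cvg0 (d : measure_display) (T : measurableType d)
    (R : realType) (P : probability T R) (k : nat) (M : 'M[R]_k)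
    (U0 : 'rV[R]_k) (U : nat -> T -> 'rV[R]_k) (Z : nat -> T -> 'I_k)
    (c : 'I_k) (w : T) :
  (2 <= k)%N -> star_matrix M ->
  ~ (k = 2%N /\ M = \matrix_(i, j) (i != j)%:R) ->
  probability_vector U0 -> neg_linear_urn P M U0 U Z -> val c = 0%N ->
  average (fun n => (Z n w == c)%:R - draw_probability U n c w) n
    @[n --> \oo] --> (0 : R) ->
  (colour_count Z n c w)%:R / n%:R @[n --> \oo] --> (0 : R).
Proof.
move=> k2 hM nswap pU0 urn c0 slln.
pose N n : R := (colour_count Z n c w)%:R.
have UE n : U n w 0 c = n.+1%:R - (1 - U0 0 c) - (1 - M c c) * N n.
  elim: n => [|n IH].
    by rewrite (urn_init urn) /N /colour_count big_ord0 mulr0 subr0 subKr.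
  rewrite (urn_content_step urn) IH /N colour_countS natrD -(natr1 n.+1).
  have [->|Zc] := eqVneq (Z n w) c; first by rewrite /=; ring.
  rewrite (hM.2 (Z n w) c) //; first by rewrite /=; ring.
  by move=> Z0; case/eqP: Zc; apply: val_inj; rewrite Z0 c0.
have /andP[Mcc0 Mcc1] := stochastic_itv c c hM.1.
have /andP[Uc0 Uc1] := probability_vector_itv c pU0.
have k1 : (1 : R) <= k%:R - 1 by exact: (natr_le_subr1 R k2).
have ik0 : 0 <= (k%:R - 1)^-1 :> R by rewrite invr_ge0; lra.
pose b n : R := (k%:R - 1)^-1 * (1 - U0 0 c) * harmonic n.
(* At n = 0 both sides vanish, division by 0 being 0. *)
have NS n : N n / n.+1%:R <= N n / n%:R.
  case: n => [|n]; first by rewrite /N /colour_count big_ord0 !mul0r.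
  by rewrite ler_wpM2l // lef_pV2 ?posrE ?ltr0n // ler_nat.
have pE n : draw_probability U n c w <=
    (k%:R - 1)^-1 * (1 - M c c) * (N n / n%:R) + b n.
  rewrite /draw_probability UE (_ : _ - _ / _ =
      (1 - U0 0 c) * harmonic n + (1 - M c c) * (N n / n.+1%:R)); last first.
    by rewrite /=; field; rewrite nat1r pnatr_eq0.
  rewrite mulrDr addrC /b -!mulrA lerD2r ler_wpM2l // ler_wpM2l //; lra.
apply: (averaged_contraction (star_matrix_contraction k2 hM c0 nswap) _
  (fun n => colour_frequency_itv R Z n c w) _ slln) => [||n].
- by rewrite mulr_ge0 // subr_ge0.
- rewrite -(mulr0 ((k%:R - 1)^-1 * (1 - U0 0 c))); apply: cvgMr.
  exact: cvg_harmonic.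
rewrite averageB -colour_frequency addrCA lerDl subr_ge0.
by rewrite ler_wpM2r // ler_sum.
Qed.

(** A leaf is fed only by draws of the centre, which have frequency 0.  Its
    proportion in the urn vanishes, so its draw probability tends to
    (k - 1)^-1. *)
Lemma leaf_frequency_cvg (d : measure_display) (T : measurableType d)
    (R : realType) (P : probability T R) (k : nat) (M : 'M[R]_k)
    (U0 : 'rV[R]_k) (U : nat -> T -> 'rV[R]_k) (Z : nat -> T -> 'I_k)
    (c j : 'I_k) (w : T) :
  star_matrix M -> neg_linear_urn P M U0 U Z -> val c = 0%N -> j != c ->
  (colour_count Z n c w)%:R / n%:R @[n --> \oo] --> (0 : R) ->
  average (fun n => (Z n w == j)%:R - draw_probability U n j w) n
    @[n --> \oo] --> (0 : R) ->
  (colour_count Z n j w)%:R / n%:R @[n --> \oo] --> ((k%:R - 1)^-1 : R).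
Proof.
move=> hM urn c0 jc freq0 slln.
have UE n : U n w 0 j = U0 0 j + M c j * (colour_count Z n c w)%:R.
  elim: n => [|n IH].
    by rewrite (urn_init urn) /colour_count big_ord0 mulr0 addr0.
  rewrite (urn_content_step urn) IH colour_countS natrD.
  have [->|Zc] := eqVneq (Z n w) c; first by rewrite /=; ring.
  by rewrite (star_matrix_off_centre hM c0 Zc jc) /= !addr0.
have N0 : (colour_count Z n c w)%:R / n.+1%:R @[n --> \oo] --> (0 : R).
  apply: (@squeeze_cvgr _ _ _ _ (cst 0)
    (fun n => (colour_count Z n c w)%:R / n%:R)) => //; last exact: cvg_cst.
  apply: nearW => n; rewrite divr_ge0 //=.
  case: n => [|n]; first by rewrite /colour_count big_ord0 !mul0r.
  by rewrite ler_wpM2l // lef_pV2 ?posrE ?ltr0n // ler_nat.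
have p_cvg : draw_probability U n j w @[n --> \oo] --> ((k%:R - 1)^-1 : R).
  rewrite (_ : (fun n => _) = fun n => (k%:R - 1)^-1 *
    (1 - (U0 0 j * harmonic n +
          M c j * ((colour_count Z n c w)%:R / n.+1%:R)))).
    rewrite -[X in _ --> X]mulr1 -[X in _ * X]subr0 -[X in _ * (_ - X)]addr0.
    rewrite -[X in _ * (_ - (X + _))](mulr0 (U0 0 j)).
    rewrite -[X in _ * (_ - (_ + X))](mulr0 (M c j)).
    apply: cvgMr; apply: cvgB; first exact: cvg_cst.
    by apply: cvgD; apply: cvgMr => //; exact: cvg_harmonic.
  by apply/funext => n; rewrite /draw_probability UE /= mulrDl mulrA.
rewrite (_ : (fun n => _) = fun n =>
    average (fun m => (Z m w == j)%:R - draw_probability U m j w) n +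
    average (fun m => draw_probability U m j w) n); last first.
  by apply/funext => n; rewrite averageB subrK colour_frequency.
by rewrite -[X in _ --> X]add0r; apply: cvgD => //; exact: average_cvg.
Qed.

Theorem theorem6 (d : measure_display) (T : measurableType d) (R : realType)
    (P : probability T R) (k : nat) (hk : (2 <= k)%N)
    (M : 'M[R]_k) (hM : star_matrix M)
    (hswap : ~ (k = 2%N /\ M = \matrix_(i, j) (i != j)%:R))
    (U0 : 'rV[R]_k) (hU0 : probability_vector U0)
    (U : nat -> T -> 'rV[R]_k) (Z : nat -> T -> 'I_k)
    (hUZ : neg_linear_urn P M U0 U Z) :
  (forall c : 'I_k, val c = 0%N ->
     {ae P, forall w, (colour_count Z n c w)%:R / n%:R @[n --> \oo] --> (0 : R)})
  /\
  (forall j : 'I_k, val j <> 0%N ->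
     {ae P, forall w, (colour_count Z n j w)%:R / n%:R @[n --> \oo]
        --> (k%:R - 1 : R)^-1}).
Proof.
have slln := urn_slln hk hM.1 hU0 hUZ.
have centre c : val c = 0%N ->
    {ae P, forall w, (colour_count Z n c w)%:R / n%:R @[n --> \oo] --> (0 : R)}.
  move=> c0; apply: filterS (slln c) => w.
  exact: (centre_frequency_cvg0 hk hM hswap hU0 hUZ c0).
split=> // j j0.
pose c : 'I_k := Ordinal (ltnW hk).
have jc : j != c by apply/eqP => jc; apply: j0; rewrite jc.
apply: filterS2 (centre c erefl) (slln j) => w.
exact: (leaf_frequency_cvg hM hUZ).
Qed.
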